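(* Consider a network with finite set of links $\mathcal{J}$, $|\mathcal{J}|\ge 2$, finite set of routes $\mathcal{R}$, link capacities $C=(C_j)_{j\in\mathcal{J}}$, $C_j>0$, and feasible set $\mathcal{C}=\{\Lambda\in\mathbb{R}_+^{\mathcal{R}}: A\Lambda\le C\}$, and suppose that it is connected and satisfies the local traffic condition. For each $r\in\mathcal{R}$ let $U_r:\mathbb{R}_+\to\mathbb{R}$ be increasing, once differentiable and strictly concave, and assume that $U_r'$ has range $(0,\infty)$. For $y\in\mathbb{R}_+^{\mathcal{R}}$ let $\Lambda(y)$ be the solution of $$\max\ U(y,\Lambda)\ \text{ over }\ \Lambda\in\mathcal{C},\qquad U(y,\Lambda)=\frac{1}{\sum_{i\in\mathcal{R}} y_i}\sum_{r\in\mathcal{R}} y_r\,U_r\Big(\frac{\Lambda_r}{y_r}\Big).$$ Then the network is flow scalable if and only if it maximizes a weighted $\alpha$-fair utility function, i.e., if and only if there exist $\alpha>0$ and $w\in\mathbb{R}_+^{\mathcal{R}}$ such that, for every $y\in\mathbb{R}_+^{\mathcal{R}}$, $\Lambda(y)$ is the maximizer of $W_{\alpha,w}(y,\Lambda)$ over $\Lambda\in\mathcal{C}$.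
   Context: Here $\mathbb{R}_+=(0,\infty)$. Network: each route consists of a nonempty set of links; $A$ is the $|\mathcal{J}|\times|\mathcal{R}|$ matrix with $A_{jr}=1$ if route $r$ uses link $j$ and $A_{jr}=0$ otherwise; $y_r$ is the number of flows on route $r$ and $\Lambda_r$ is the bandwidth allocated to route $r$. Local traffic condition: each link has a route that uses that link only, i.e., for every $j\in\mathcal{J}$ there exists $r\in\mathcal{R}$ such that $A_{jr}=1$ and $A_{lr}=0$ for all $l\ne j$. Connected: for all links $j,l\in\mathcal{J}$ there exists a sequence of links and routes $j_0,r_0,j_1,r_1,\dots,r_{K-1},j_K$ such that $j_0=j$, $j_K=l$, and $A_{j_kr_k}=A_{j_{k+1}r_k}=1$ for $k=0,\dots,K-1$. Flow scalable: the network (utility function $U$ optimized over the fixed capacity set $\mathcal{C}$) is flow scalable if $\Lambda(y)=\Lambda(ay)$ for all $a>0$ and all $y\in\mathbb{R}_+^{\mathcal{R}}$. Weighted $\alpha$-fair utility functions: for $\alpha>0$ and $w\in\mathbb{R}_+^{\mathcal{R}}$, $$W_{\alpha,w}(y,\Lambda)=\begin{cases}\dfrac{1}{\sum_{i\in\mathcal{R}} y_i}\displaystyle\sum_{r\in\mathcal{R}}\frac{w_r y_r}{1-\alpha}\Big(\frac{\Lambda_r}{y_r}\Big)^{1-\alpha} & \text{if }\alpha\ne 1,\\[2ex] \dfrac{1}{\sum_{i\in\mathcal{R}} y_i}\displaystyle\sum_{r\in\mathcal{R}} w_r y_r\log\Big(\frac{\Lambda_r}{y_r}\Big) & \text{if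 }\alpha=1.\end{cases}$$ *)

(* Defs.v *)
From HB Require Import structures.
From mathcomp Require Import all_boot all_order all_algebra.
From mathcomp Require Import all_classical all_reals all_analysis.
Set Implicit Arguments.
Unset Strict Implicit.
Unset Printing Implicit Defensive.
Import Order.TTheory GRing.Theory Num.Theory.
Import numFieldNormedType.Exports.
Local Open Scope classical_set_scope.
Local Open Scope ring_scope.

Section Network.
Variables (R : realType) (J Rt : finType).

(* A vector indexed by the routes is a function [Rt -> R]; the link-route
   incidence matrix is a boolean matrix, [A j r] meaning that route [r] uses
   link [j], so that its 0/1 real entries are [(A j r)%:R]. *)
Implicit Types (A : J -> Rt -> bool) (C : J -> R) (y w L : Rt -> R).

Definition positive_vec y : Prop := forall r, 0 < y r.

Definition feasible A C : set (Rt -> R) :=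
  [set L | positive_vec L /\ forall j, \sum_r (A j r)%:R * L r <= C j].

Definition local_traffic A : Prop :=
  forall j, exists r, A j r /\ forall l, l != j -> ~~ A l r.

(* Only the values [js 0], ..., [js K] and [rs 0], ..., [rs K.-1] matter. *)
Definition connected_network A : Prop :=
  forall j l, exists (K : nat) (js : nat -> J) (rs : nat -> Rt),
    [/\ js 0%N = j, js K = l &
        forall k, (k < K)%N -> A (js k) (rs k) /\ A (js k.+1) (rs k)].

Definition argmax (T : Type) (D : set T) (F : T -> R) : set T :=
  [set x | D x /\ forall x', D x' -> F x' <= F x].

Definition utility (U : Rt -> R -> R) y L : R :=
  (\sum_i y i)^-1 * \sum_r y r * U r (L r / y r).

(* The weighted alpha-fair utility W_{alpha,w}(y, L). *)
Definition alpha_fair (alpha : R) w y L : R :=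
  if alpha == 1 then
    (\sum_i y i)^-1 * \sum_r w r * y r * ln (L r / y r)
  else
    (\sum_i y i)^-1 *
    \sum_r w r * y r / (1 - alpha) * (L r / y r) `^ (1 - alpha).

Definition flow_scalable (Lam : (Rt -> R) -> (Rt -> R)) : Prop :=
  forall (a : R) y, 0 < a -> positive_vec y ->
    Lam y = Lam (fun r => a * y r).

(* The optimizer being unique, the set of maximizers is the singleton of the
   allocation. *)
Definition maximizes_alpha_fair A C (Lam : (Rt -> R) -> (Rt -> R)) : Prop :=
  exists (alpha : R) w, [/\ 0 < alpha, positive_vec w &
    forall y, positive_vec y ->
      argmax (feasible A C) (alpha_fair alpha w y) = [set Lam y]].

End Network.

Section Utility.
Variable R : realType.
Implicit Type u : R -> R.

(* Utilities live on (0, +oo); their values elsewhere are never constrained. *)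
Definition increasing_pos u : Prop :=
  forall x z, 0 < x -> x < z -> u x < u z.

Definition differentiable_pos u : Prop :=
  forall x, 0 < x -> derivable u x 1.

Definition strictly_concave_pos u : Prop :=
  forall x z t, 0 < x -> 0 < z -> x != z -> 0 < t -> t < 1 ->
    t * u x + (1 - t) * u z < u (t * x + (1 - t) * z).

Definition derivative_range_pos u : Prop :=
  derive1 u @` [set x | 0 < x] = [set x | 0 < x].

End Utility.

(* Main.v *)
Require Import Defs.
From mathcomp Require Import all_boot all_order all_algebra.
From mathcomp Require Import all_classical all_reals all_analysis.
From mathcomp Require Import ring lra.
Import Order.TTheory GRing.Theory Num.Theory.
Import numFieldNormedType.Exports.
Local Open Scope classical_set_scope.
Local Open Scope ring_scope.

Set Implicit Arguments.
Unset Strict Implicit.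
Unset Printing Implicit Defensive.

(** Let [u r] be the derivative of [U r].  An allocation [L] is optimal for the
    numbers of flows [y] exactly when there are positive link prices [p] such
    that every link is saturated and [u r (L r / y r)] is the sum of the prices
    of the links of [r].  Sufficiency is the tangent inequality
    ([supported_by_prices_optimal]); for necessity the price of a link is read
    off the route that uses this link only ([argmax_supported_by_prices]).  The
    optimum is therefore unique ([argmax_unique]).

    Suppose that the network is flow scalable, and fix an optimal [L].  For every
    price vector [p] some [y] makes [L] optimal with prices [p], and then [L] is
    also optimal for [a * y].  Writing [g r q := u r ((u r)^-1 q / a)], this says
    that [g r] of the sum of the prices along [r] is the sum of the [g (loc j)]
    of the prices, [loc j] being a local route of link [j]
    ([flow_scalable_splits]).  Each [g r] is an increasing bijection of the
    half-line, so on a route with at least two links this Pexider equation forces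
    all these functions to be linear with the same slope
    ([splits_over_linear]).  Since there are at least two links and the network is
    connected, every link lies on such a route and the slope is the same on the
    whole network: [u r (x / a) = c a * u r x] for all [r], [x] and [a]
    ([flow_scalable_common_slope]).  Then [c] is multiplicative and increasing,
    so it is a power [a `^ alpha] with [alpha > 0], and
    [u r x = w r * x `^ (- alpha)] with [w r := u r 1] ([flow_scalable_power]).
    Integrating, the given utility and the alpha-fair utility differ by an amount
    that does not depend on the allocation, so they have the same unique
    maximizer.

    Conversely, multiplying [y] by a positive constant changes an alpha-fair
    utility by an increasing affine map, which preserves its maximizers
    ([maximizes_alpha_fair_flow_scalable]). *)

(** * Strictly concave functions on the half-line *)

Section ConcaveCalculus.
Variable R : realType.
Implicit Types (u g : R -> R) (x z d m : R).

(** Pass to the limit in the difference quotients from the right. *)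
Lemma le_derive_of_chord g d m : is_derive (0 : R) (1 : R) g d ->
  (forall t, 0 < t -> t < 1 -> t * m <= g t - g 0) -> m <= d.
Proof.
move=> gd chord; have <- := @derive_val _ _ _ _ _ _ _ gd.
have gdrv : derivable g 0 (1 : R) by exact: ex_derive.
rewrite ['D_1 g 0]cvg_at_rightE //; apply: limr_ge.
  rewrite -(cvg_at_rightE (fun h : R => h^-1 *: ((g \o shift 0) _ - g 0))) //.
  apply: cvg_trans gdrv; apply: cvg_app => A [e egt0 Ae]; exists e => // x xe x0.
  by apply: Ae => //; exact: lt0r_neq0.
near=> h.
have h0 : 0 < h by near: h; exact: nbhs_right_gt.
rewrite /= [h%:A]mulr1 addr0 [_ *: _]mulrC ler_pdivlMr // mulrC chord //.
Unshelve. all: by end_near. Qed.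

Lemma is_derive_line u x k t : derivable u (x + t * k) 1 ->
  is_derive t 1 (fun s => u (x + s * k)) ('D_1 u (x + t * k) * k).
Proof.
move=> /derivableP ud.
have -> : (fun s => u (x + s * k)) = u \o (cst x + k \*: id).
  by apply/funext => s /=; rewrite /cst /= mulrC.
have et : (cst x + k \*: id) t = x + t * k by rewrite mulrC.
apply: is_derive1_comp; first by rewrite et.
by apply: is_derive_eq; rewrite add0r [_ *: _]mulr1.
Qed.

(** Concavity puts the chord from [x] below the graph, and the limit of the
    chord slopes gives the weak inequality.  Applying the weak inequality at
    the midpoint of [x] and [z], where the graph is strictly above the chord,
    makes it strict. *)
Lemma tangent_strict u x z : differentiable_pos u -> strictly_concave_pos u ->
  0 < x -> 0 < z -> x != z -> u z - u x < derive1 u x * (z - x).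
Proof.
move=> ud uc x0 z0 xz; rewrite derive1E.
suff tangent : forall z, 0 < z -> x != z -> u z - u x <= 'D_1 u x * (z - x).
  have m0 : 0 < 2^-1 * x + (1 - 2^-1) * z by lra.
  have xm : x != 2^-1 * x + (1 - 2^-1) * z.
    by apply: contra xz => /eqP e; apply/eqP; lra.
  have := tangent _ m0 xm; have := uc x z 2^-1 x0 z0 xz ltac:(lra) ltac:(lra).
  have -> : 2^-1 * x + (1 - 2^-1) * z - x = 2^-1 * (z - x) by field.
  rewrite [_ * (2^-1 * _)]mulrCA.
  move: ('D_1 u x * _) (u _) (u x) (u z) => d a b c; lra.
move=> {}z {}z0 {}xz.
have ux : derivable u (x + 0 * (z - x)) 1 by rewrite mul0r addr0; exact: ud.
apply: (@le_derive_of_chord (fun s => u (x + s * (z - x)))).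
  by have := is_derive_line ux; rewrite mul0r addr0.
move=> t t0 t1; rewrite mul0r addr0.
have := uc z x t z0 x0 ltac:(by rewrite eq_sym) t0 t1.
have -> : t * z + (1 - t) * x = x + t * (z - x) by ring.
by move: (u _) (u x) (u z) => a b c; lra.
Qed.

(** Add the tangent inequalities at [x] and at [z]. *)
Lemma derive1_decreasing u x z :
  differentiable_pos u -> strictly_concave_pos u ->
  0 < x -> x < z -> derive1 u z < derive1 u x.
Proof.
move=> ud uc x0 xz; have z0 := lt_trans x0 xz.
have := tangent_strict ud uc x0 z0 ltac:(by rewrite lt_eqF).
have := tangent_strict ud uc z0 x0 ltac:(by rewrite gt_eqF).
by move: (derive1 u z) (derive1 u x) (u x) (u z) => a b c d; nra.
Qed.

Lemma eq_derive1_diff (f g : R -> R) x z :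
  differentiable_pos f ->
  (forall t : R, 0 < t -> is_derive t 1 g (derive1 f t)) ->
  0 < x -> 0 < z -> f x - g x = f z - g z.
Proof.
move=> fd gd; wlog xz : x z / x < z.
  move=> H x0 z0; have [xz|zx|->//] := ltgtP x z; first exact: H.
  by symmetry; exact: H.
move=> x0 z0.
have hd (t : R) : 0 < t -> is_derive t 1 (f - g) 0.
  move=> t0; have := gd t t0; have /derivableP := fd t t0; rewrite -derive1E => *.
  by apply: is_derive_eq; rewrite subrr.
have itv_pos (t : R) : t \in `[x, z] -> 0 < t.
  by rewrite in_itv => /andP[/(lt_le_trans x0)].
have [|||c _] := @MVT R (f - g) (cst 0) x z.
- by [].
- by move=> t txz; apply: hd; apply: itv_pos; exact: subset_itv_oo_cc.
- by apply: derivable_within_continuous => t /itv_pos /hd dt; exact: ex_derive.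
by rewrite /cst mul0r => /eqP; rewrite subr_eq0 => /eqP.
Qed.

End ConcaveCalculus.

(** * Cauchy-type functional equations on the half-line *)

Section FunctionalEquations.
Variables (R : realType) (J : finType).
Implicit Types (G h c u : R -> R) (g : J -> R -> R) (S : {set J}).

(** Monotone surjections of the half-line onto itself have no jumps and tend
    to 0 at 0, so this notion stands in for continuity in every limit argument
    of this part. *)
Definition increasing_bijection_pos G : Prop :=
  [/\ increasing_pos G, forall x, 0 < x -> 0 < G x &
      forall v, 0 < v -> exists2 x, 0 < x & G x = v].

Lemma increasing_pos_le G x z : increasing_pos G ->
  0 < x -> x <= z -> G x <= G z.
Proof.
by move=> Ginc x0; rewrite le_eqVlt => /predU1P[->//|xz]; apply/ltW/Ginc.
Qed.

(** Morally [q] tends to 0, where [h] vanishes and [G] is continuous.  A gap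
    between [G s] and [T] is excluded by surjectivity: were [G s] larger, some
    value of [h] would equal the gap; were it smaller, [G] would take the value
    [T] to the right of [s], where the equation makes it exceed [T]. *)
Lemma eq_at_right_end G h s T :
  increasing_bijection_pos G -> increasing_bijection_pos h -> 0 < s ->
  (forall q, 0 < q -> G (s + q) = T + h q) -> G s = T.
Proof.
move=> [Ginc Gpos Gonto] [_ hpos honto] s0 Gh.
apply/eqP; rewrite eq_le !leNgt; apply/andP; split; apply/negP => lt_sT.
- have [q q0 hq] := honto (G s - T) ltac:(by rewrite subr_gt0).
  have := Ginc s (s + q) s0 ltac:(by rewrite ltrDl).
  by rewrite Gh // hq addrC subrK ltxx.
- have [t t0 Gt] := Gonto T (lt_trans (Gpos s s0) lt_sT).
  have st : s < t.
    rewrite ltNge; apply/negP => /(increasing_pos_le Ginc t0).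
    by rewrite Gt leNgt lt_sT.
  have := Gh (t - s) ltac:(by rewrite subr_gt0).
  have := hpos (t - s) ltac:(by rewrite subr_gt0).
  by rewrite [s + _]addrC subrK Gt; lra.
Qed.

(** The additivity that the dual prices of a scaled network satisfy: [S] is the
    set of links of one route and [p] the vector of link prices. *)
Definition splits_over G g S : Prop := forall p : J -> R, (forall j, 0 < p j) ->
  G (\sum_(j in S) p j) = \sum_(j in S) g j (p j).

(** Let the price of link [k] go to 0. *)
Lemma splits_over_setD1 G g S k :
  increasing_bijection_pos G -> increasing_bijection_pos (g k) ->
  k \in S -> (S :\ k != finset.set0)%SET -> splits_over G g S ->
  splits_over G g (S :\ k)%SET.
Proof.
move=> Gb gb kS /finset.set0Pn[j jS] GS p p0.
apply: (eq_at_right_end Gb gb).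
  rewrite (big_setD1 j) //= ltr_wpDr //.
  by apply: sumr_ge0 => i _; exact: ltW.
move=> q q0; pose p' i := if i == k then q else p i.
have p'0 i : 0 < p' i by rewrite /p'; case: ifP.
have := GS _ p'0; rewrite !(big_setD1 k kS) /= {1 3}/p' eqxx.
have p'E i : i \in S :\ k -> p' i = p i.
  by rewrite /p' !inE => /andP[/negPf->].
have -> : \sum_(i in (S :\ k)%SET) p' i = \sum_(i in (S :\ k)%SET) p i.
  by apply: eq_bigr => i /p'E ->.
have -> : \sum_(i in (S :\ k)%SET) g i (p' i) =
          \sum_(i in (S :\ k)%SET) g i (p i).
  by apply: eq_bigr => i /p'E ->.
by rewrite [q + _]addrC [g k q + _]addrC.
Qed.

Lemma splits_over_subset G g S S' : increasing_bijection_pos G ->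
  (forall j, increasing_bijection_pos (g j)) -> S' \subset S ->
  S' != finset.set0 -> splits_over G g S -> splits_over G g S'.
Proof.
move=> Gb gb; have [n] := ubnP #|S|; elim: n S => // n IH S Sn S'S S'0 GS.
have [->//|neqS] := eqVneq S' S.
have /properP[_ [k kS kS']] : S' \proper S by rewrite finset.properEneq neqS.
have S'Sk : S' \subset S :\ k by rewrite finset.subsetD1 S'S.
apply: (IH (S :\ k)%SET) => //.
  by rewrite (leq_trans _ (Sn : (#|S| <= n)%N)) // [X in (_ < X)%N](cardsD1 k) kS.
apply: splits_over_setD1 => //.
by apply: contraNN S'0 => /eqP Sk0; rewrite Sk0 finset.subset0 in S'Sk.
Qed.

(** The comparison [m z <= n y < (m + 1) z] transfers through [G] with the same
    integers, so [G y / y] and [G z / z] differ by less than any positive number;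
    monotonicity is what replaces continuity. *)
Lemma additive_pos_linear G x : increasing_pos G ->
  (forall x, 0 < x -> 0 < G x) ->
  (forall x z, 0 < x -> 0 < z -> G (x + z) = G x + G z) ->
  0 < x -> G x = x * G 1.
Proof.
move=> Ginc Gpos Gadd x0.
have GMn (n : nat) z : 0 < z -> G (n.+1%:R * z) = n.+1%:R * G z.
  move=> z0; elim: n => [|n IH]; first by rewrite !mul1r.
  rewrite -addn1 natrD !mulrDl !mul1r Gadd ?IH //.
  by rewrite mulr_gt0 // ltr0n.
have le_lin y z : 0 < y -> 0 < z -> G y * z <= y * G z.
  move=> y0 z0; rewrite leNgt; apply/negP => lt_yz.
  have e0 : 0 < G y * z - y * G z by rewrite subr_gt0.
  have Gzz0 : 0 < z * G z by rewrite mulr_gt0 // Gpos.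
  (* [n] is so large that an error of one unit in [m] cannot absorb the gap. *)
  pose n := Num.trunc (z * G z / (G y * z - y * G z)).
  have := truncnS_gt (z * G z / (G y * z - y * G z)); rewrite -/n.
  rewrite ltr_pdivrMr // => ltn.
  pose m := Num.trunc (n.+1%:R * y / z).
  have n0 : 0 < n.+1%:R :> R by rewrite ltr0n.
  have /truncn_itv/andP[] : 0 <= n.+1%:R * y / z.
    by rewrite ltW // divr_gt0 // mulr_gt0.
  rewrite -/m ler_pdivlMr // ltr_pdivrMr // => mle ltm.
  have ny0 : 0 < n.+1%:R * y by rewrite mulr_gt0.
  have := Ginc _ _ ny0 ltm; rewrite !GMn // -(ltr_pM2r z0).
  rewrite -(ler_pM2r (Gpos z z0)) in mle.
  have -> : m.+1%:R = m%:R + 1 :> R by rewrite -addn1 natrD.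
  move: ltn mle; move: (G y) (G z) (n.+1%:R : R) (m%:R : R) => a b c d; lra.
apply/eqP; rewrite eq_le; apply/andP; split.
  by have := le_lin x 1 x0 ltr01; rewrite mulr1.
by have := le_lin 1 x ltr01 x0; rewrite mul1r mulrC.
Qed.

(** Restricting the equation to a single link [i] identifies [G] with each
    [g i], and restricting it to a pair turns it into the Cauchy equation.
    This is where routes with at least two links are needed. *)
Lemma splits_over_linear G g S j : increasing_bijection_pos G ->
  (forall j, increasing_bijection_pos (g j)) -> splits_over G g S ->
  j \in S -> (1 < #|S|)%N ->
  forall p, 0 < p -> g j p = p * g j 1 /\ G p = p * g j 1.
Proof.
move=> Gb gb GS jS.
rewrite (cardsD1 j) jS ltnS => /card_gt0P[l]; rewrite !inE => /andP[lj lS].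
have one i p : i \in S -> 0 < p -> G p = g i p.
  move=> iS p0; have GSi : splits_over G g [set i]%SET.
    apply: splits_over_subset GS => //; first by rewrite finset.sub1set.
    by apply/finset.set0Pn; exists i; rewrite inE.
  by have := GSi (fun=> p) (fun=> p0); rewrite !big_set1.
have GSjl : splits_over G g [set j; l]%SET.
  apply: splits_over_subset GS => //.
    by rewrite finset.subUset !finset.sub1set jS.
  by apply/finset.set0Pn; exists j; rewrite !inE eqxx.
have [Ginc Gpos _] := Gb.
have Gadd x z : 0 < x -> 0 < z -> G (x + z) = G x + G z.
  move=> x0 z0; pose p i := if i == j then x else z.
  have p0 i : 0 < p i by rewrite /p; case: ifP.
  have := GSjl p p0; rewrite !big_setU1 ?inE ?(eq_sym j) //= !big_set1.
  by rewrite /p eqxx (negPf lj) -!one.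
by move=> p p0; rewrite -!one //; split; exact: additive_pos_linear.
Qed.

(** In logarithmic coordinates this is the additive equation; the exponent is
    the logarithm of [c e]. *)
Lemma multiplicative_pos_power c : increasing_pos c ->
  (forall x, 0 < x -> 0 < c x) ->
  (forall x z, 0 < x -> 0 < z -> c (x * z) = c x * c z) ->
  exists2 alpha, 0 < alpha & forall x, 0 < x -> c x = x `^ alpha.
Proof.
move=> cinc cpos cmul.
have c1 : c 1 = 1.
  have := cmul 1 1 ltr01 ltr01; rewrite mulr1 => /eqP.
  rewrite -subr_eq0 -{1}[c 1]mulr1 -mulrBr mulf_eq0 gt_eqF ?cpos //=.
  by rewrite subr_eq0 => /eqP.
pose F s := ln (c (expR s)).
have e0 (s : R) : 0 < expR s := expR_gt0 s.
have Finc : increasing_pos F.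
  by move=> s t _ st; rewrite /F ltr_ln ?posrE ?cpos // cinc // ltr_expR.
have Fpos s : 0 < s -> 0 < F s.
  by move=> s0; rewrite /F ln_gt0 // -c1 cinc // expR_gt1.
have Fadd s t : 0 < s -> 0 < t -> F (s + t) = F s + F t.
  by move=> s0 t0; rewrite /F expRD cmul // lnM ?posrE ?cpos.
have gt1 x : 1 < x -> c x = x `^ F 1.
  move=> x1; have x0 := lt_trans ltr01 x1.
  have := additive_pos_linear Finc Fpos Fadd (ln_gt0 x1).
  rewrite {1}/F lnK ?posrE // => E.
  by rewrite /powR gt_eqF // mulrC -E lnK // posrE cpos.
exists (F 1); first exact: Fpos.
move=> x x0; have [x1|x1|->] := ltgtP x 1; last by rewrite powR1.
- have xV1 : 1 < x^-1 by rewrite invf_gt1.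
  have xV0 : 0 < x^-1 by rewrite invr_gt0.
  have := cmul x x^-1 x0 xV0; rewrite divff ?gt_eqF // c1 (gt1 x^-1) // => E.
  have := powRM (F 1) (ltW x0) (ltW xV0); rewrite divff ?gt_eqF // powR1 => E'.
  apply: (@mulIf _ (x^-1 `^ F 1)); first by rewrite gt_eqF // powR_gt0.
  by rewrite -E -E'.
- exact: gt1.
Qed.

End FunctionalEquations.

(** * Link prices of optimal allocations *)

Section Prices.
Variables (R : realType) (J Rt : finType).
Variables (A : J -> Rt -> bool) (C : J -> R) (U : Rt -> R -> R).
Implicit Types (y L d : Rt -> R) (p : J -> R).

Local Notation u r := (derive1 (U r)).

(** The Karush-Kuhn-Tucker conditions.  Positive prices force every link to be
    saturated, so complementary slackness reads as an equality. *)
Definition supported_by_prices y L p : Prop :=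
  [/\ forall j, 0 < p j, forall j, \sum_r (A j r)%:R * L r = C j &
      forall r, u r (L r / y r) = \sum_j (A j r)%:R * p j].

Lemma sum_pos_gt0 y (r : Rt) : positive_vec y -> 0 < \sum_s y s.
Proof.
move=> y0; rewrite (bigD1 r) //= ltr_wpDr //.
by apply: sumr_ge0 => s _; exact/ltW/y0.
Qed.

Hypothesis Udiff : forall r, differentiable_pos (U r).
Hypothesis Uconc : forall r, strictly_concave_pos (U r).

(** Bound each utility by its tangent at [L]: the total gain of [L'] is below
    the price of the capacity that [L'] uses in excess of [L], and [L] uses
    all of it. *)
Lemma supported_by_prices_optimal y L L' p : positive_vec y -> positive_vec L ->
  feasible A C L' -> L' <> L -> supported_by_prices y L p ->
  \sum_r y r * U r (L' r / y r) < \sum_r y r * U r (L r / y r).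
Proof.
move=> y0 L0 [L'0 L'C] neqL [p0 LC Lp].
have [r Lr] : exists r, L r != L' r.
  apply/not_existsP => eqL; apply: neqL; apply/funext => r.
  by have /negP/negPn/eqP := eqL r.
pose q s := \sum_j (A j s)%:R * p j.
have tangent s : L s != L' s ->
    y s * U s (L' s / y s) < y s * U s (L s / y s) + q s * (L' s - L s).
  move=> Ls; have ys0 := y0 s.
  have ne : L s / y s != L' s / y s.
    by apply: contra Ls => /eqP/mulIf -> //; rewrite invr_eq0 gt_eqF.
  have := tangent_strict (@Udiff s) (@Uconc s) (divr_gt0 (L0 s) ys0)
            (divr_gt0 (L'0 s) ys0) ne.
  rewrite Lp -/(q s) -(ltr_pM2l ys0) mulrBr.
  have -> : y s * (q s * (L' s / y s - L s / y s)) = q s * (L' s - L s).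
    by field; rewrite gt_eqF.
  by rewrite ltrBlDl.
have tangent_le s :
    y s * U s (L' s / y s) <= y s * U s (L s / y s) + q s * (L' s - L s).
  have [->|/tangent/ltW//] := eqVneq (L s) (L' s).
  by rewrite subrr mulr0 addr0.
have value : \sum_s q s * (L' s - L s) <= 0.
  under eq_bigr do rewrite mulr_suml.
  rewrite exchange_big /=; apply: sumr_le0 => j _.
  under eq_bigr do rewrite mulrAC mulrC mulrBr.
  rewrite -mulr_sumr sumrB LC pmulr_rle0 // subr_le0; exact: L'C.
apply: (@lt_le_trans _ _
  (\sum_s (y s * U s (L s / y s) + q s * (L' s - L s)))).
  rewrite (bigD1 r) //= [ltRHS](bigD1 r) //= ltr_leD ?tangent //.
  by apply: ler_sum.
by rewrite big_split /= gerDl.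
Qed.

Lemma is_derive_finsum (f : Rt -> R -> R) (df : Rt -> R) (x : R) :
  (forall s, is_derive x 1 (f s) (df s)) ->
  is_derive x 1 (fun t => \sum_s f s t) (\sum_s df s).
Proof.
move=> fd; have -> : (fun t => \sum_s f s t) = \sum_s f s.
  by apply/funext => t; rewrite fct_sumE.
by elim/big_ind2 : _ => // [|] *; [exact: is_derive_cst|exact: is_deriveD].
Qed.

(** The constraint [0 < L s] is open, so only the capacity constraints limit
    the directions in which an allocation can move. *)
Lemma small_perturbation_pos L d : positive_vec L ->
  exists2 e : R, 0 < e &
    forall t, - e < t -> t < e -> positive_vec (fun s => L s + t * d s).
Proof.
(* [M] exceeds every ratio [`|d s| / L s], so [e := M^-1] works for all [s]. *)
move=> L0; pose M := 1 + \sum_s `|d s| / L s.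
have q0 s : 0 <= `|d s| / L s by rewrite divr_ge0 // ltW.
have M0 : 0 < M by rewrite /M ltr_wpDr // sumr_ge0.
exists M^-1; first by rewrite invr_gt0.
move=> t tl tr s; have Ls := L0 s.
have : `|t| * M < 1 by rewrite -ltr_pdivlMr // div1r ltr_norml tl.
have dM : `|d s| < L s * M.
  rewrite -ltr_pdivrMl // mulrC /M (bigD1 s) //= addrCA ltrDl ltr_wpDr //.
  by apply: sumr_ge0.
move=> tM; have : `|t * d s| < L s.
  rewrite normrM; have [->|t0] := eqVneq t 0; first by rewrite normr0 mul0r.
  have t0' : 0 < `|t| by rewrite normr_gt0.
  apply: (@lt_le_trans _ _ (`|t| * (L s * M))); first by rewrite ltr_pM2l.
  by rewrite mulrCA ger_pMr // ltW.
by rewrite ltr_norml => /andP[+ _]; rewrite -ltrBlDl sub0r.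
Qed.

Lemma utility_le y L L' (r : Rt) : positive_vec y ->
  (utility U y L' <= utility U y L) =
  (\sum_r y r * U r (L' r / y r) <= \sum_r y r * U r (L r / y r)).
Proof.
by move=> y0; rewrite /utility ler_pM2l // invr_gt0; exact: sum_pos_gt0.
Qed.

Lemma supported_by_prices_argmax_eq y L L' p : positive_vec y ->
  feasible A C L -> supported_by_prices y L p ->
  argmax (feasible A C) (utility U y) L' -> L' = L.
Proof.
move=> y0 Lfeas Lp [L'feas L'ge]; apply: contrapT => neqL.
case: (pickP (@predT Rt)) => [r _|noR]; last first.
  by apply: neqL; apply/funext => r; have := noR r.
have := L'ge L Lfeas; rewrite utility_le // leNgt => /negP; apply.
exact: (supported_by_prices_optimal y0 Lfeas.1 L'feas neqL Lp).
Qed.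

(** A direction that changes no link load can be followed both ways, so the
    utility has an interior maximum along it. *)
Lemma argmax_stationary y L d : positive_vec y ->
  argmax (feasible A C) (utility U y) L ->
  (forall j, \sum_s (A j s)%:R * d s = 0) ->
  \sum_s d s * u s (L s / y s) = 0.
Proof.
move=> y0 [[L0 LC] Lmax] Ad.
case: (pickP (@predT Rt)) => [r _|noR]; last by rewrite big_pred0.
have [e e0 Le] := small_perturbation_pos d L0.
pose phi t := \sum_s y s * U s (L s / y s + t * (d s / y s)).
have phiE t : phi t = \sum_s y s * U s ((L s + t * d s) / y s).
  by apply: eq_bigr => s _; rewrite mulrDl mulrA.
have dphi t : - e < t -> t < e -> is_derive t 1 phi
    (\sum_s y s * ('D_1 (U s) (L s / y s + t * (d s / y s)) * (d s / y s))).
  move=> te1 te2; apply: is_derive_finsum => s.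
  apply: is_deriveZ; apply: is_derive_line; apply: Udiff.
  by rewrite mulrA -mulrDl divr_gt0 //; exact: Le.
have phi0 : is_derive (0 : R) (1 : R) phi 0.
  apply: (@derive1_at_max _ phi (- e) e).
  - by rewrite ge0_cp // ltW.
  - move=> t; rewrite in_itv /= => /andP[t1 t2].
    by have dt := dphi t t1 t2; exact: ex_derive.
  - by rewrite in_itv /= oppr_lt0 e0.
  - move=> t; rewrite in_itv /= => /andP[t1 t2].
    have : utility U y (fun s => L s + t * d s) <= utility U y L.
      apply: Lmax; split=> [|j]; first exact: Le.
      under eq_bigr do rewrite mulrDr mulrCA.
      by rewrite big_split /= -mulr_sumr Ad mulr0 addr0.
    rewrite utility_le // -phiE; congr (_ <= _).
    by rewrite phiE; apply: eq_bigr => s _; rewrite mul0r addr0.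
have d0 := dphi 0 ltac:(by rewrite oppr_lt0) e0.
have := etrans (esym (@derive_val _ _ _ _ _ _ _ d0))
               (@derive_val _ _ _ _ _ _ _ phi0).
move=> E; rewrite -[RHS]E; apply: eq_bigr => s _.
rewrite mul0r addr0 derive1E mulrCA [X in _ = _ * X]mulrC divfK ?gt_eqF //.
by rewrite mulrC.
Qed.

Hypothesis Uinc : forall r, increasing_pos (U r).

(** Spare capacity on [j] could be given to a route that uses only [j]. *)
Lemma argmax_saturates y L j r : positive_vec y ->
  argmax (feasible A C) (utility U y) L ->
  (forall l, A l r = (l == j)) -> \sum_s (A j s)%:R * L s = C j.
Proof.
move=> y0 [[L0 LC] Lmax] locr; apply/eqP; rewrite eq_le LC leNgt /=.
apply/negP => slack; pose delta := C j - \sum_s (A j s)%:R * L s.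
have delta0 : 0 < delta by rewrite subr_gt0.
pose L' s := L s + (s == r)%:R * delta.
have : utility U y L' <= utility U y L.
  apply: Lmax; split=> [s|l].
    by rewrite /L' ltr_wpDr // mulr_ge0 ?ler0n // ltW.
  under eq_bigr do rewrite mulrDr.
  rewrite big_split /=.
  have -> : \sum_s (A l s)%:R * ((s == r)%:R * delta) = (A l r)%:R * delta.
    rewrite (bigD1 r) //= eqxx mul1r big1 ?addr0 // => s /negPf->.
    by rewrite mul0r mulr0.
  rewrite locr; have [->|_] := eqVneq l j; last by rewrite mul0r addr0.
  by rewrite mul1r addrC subrK.
rewrite utility_le // leNgt => /negP; apply.
rewrite (bigD1 r) //= [ltRHS](bigD1 r) //= /L' eqxx mul1r ltr_leD //.
  rewrite ltr_pM2l // Uinc ?divr_gt0 // ltr_pM2r ?invr_gt0 //.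
  by rewrite ltrDl.
by apply: ler_sum => s /negPf->; rewrite mul0r addr0.
Qed.

Variable loc : J -> Rt.
Hypothesis locP : forall l j, A l (loc j) = (l == j).
Hypothesis Upos : forall r x, 0 < x -> 0 < u r x.

(** The local traffic condition yields multipliers without any duality theorem:
    the price of a link is the marginal utility on its local route.  Increasing
    the rate of [r] by one unit and decreasing those of the local routes of its
    links by one unit leaves all loads unchanged, and stationarity in that
    direction says that the marginal utility of [r] is the sum of the prices. *)
Lemma argmax_supported_by_prices y L : positive_vec y ->
  argmax (feasible A C) (utility U y) L ->
  supported_by_prices y L (fun j => u (loc j) (L (loc j) / y (loc j))).
Proof.
move=> y0 Lmax; have [[L0 _] _] := Lmax; split=> [j|j|r].
- by rewrite Upos // divr_gt0.
- by apply: (@argmax_saturates _ _ _ (loc j)) => // l.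
pose d s : R := (s == r)%:R - \sum_j (A j r)%:R * (s == loc j)%:R.
have pick (f : Rt -> R) r' : \sum_s f s * (s == r')%:R = f r'.
  rewrite (bigD1 r') //= eqxx mulr1 big1 ?addr0 // => s /negPf->.
  by rewrite mulr0.
have pick_d (f : Rt -> R) :
    \sum_s f s * d s = f r - \sum_j (A j r)%:R * f (loc j).
  under eq_bigr do rewrite mulrBr mulr_sumr.
  rewrite sumrB pick exchange_big /=; congr (_ - _); apply: eq_bigr => j _.
  by under eq_bigr do rewrite mulrCA; rewrite -mulr_sumr pick.
have dA l : \sum_s (A l s)%:R * d s = 0.
  rewrite pick_d (bigD1 l) //= locP eqxx mulr1 big1 ?addr0 ?subrr // => j jl.
  by rewrite locP eq_sym (negPf jl) mulr0.
have := argmax_stationary y0 Lmax dA.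
under eq_bigr do rewrite mulrC.
by rewrite pick_d => /eqP; rewrite subr_eq0 => /eqP.
Qed.

Lemma argmax_unique y L L' : positive_vec y ->
  argmax (feasible A C) (utility U y) L ->
  argmax (feasible A C) (utility U y) L' -> L' = L.
Proof.
move=> y0 Lmax; apply: supported_by_prices_argmax_eq Lmax.1 _ => //.
exact: argmax_supported_by_prices.
Qed.

End Prices.

(** * Rescaling a decreasing marginal utility *)

Section RescaledInverse.
Variable R : realType.
Implicit Types (u v : R -> R).

Lemma decreasing_pos_inj u x z : (forall x z, 0 < x -> x < z -> u z < u x) ->
  0 < x -> 0 < z -> u x = u z -> x = z.
Proof.
move=> udec x0 z0 E; have [xz|zx|//] := ltgtP x z.
  by have := udec _ _ x0 xz; rewrite E ltxx.
by have := udec _ _ z0 zx; rewrite E ltxx.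
Qed.

(** With [v] the inverse of the marginal utility [u], the function
    [q |-> u (v q / a)] tells what becomes of the marginal utility [q] of a
    route when the number of flows is multiplied by [a] at constant
    allocation. *)
Lemma rescaled_inverse_increasing_bijection u v a : 0 < a ->
  (forall x z, 0 < x -> x < z -> u z < u x) -> (forall x, 0 < x -> 0 < u x) ->
  (forall q, 0 < q -> 0 < v q /\ u (v q) = q) ->
  increasing_bijection_pos (fun q => u (v q / a)).
Proof.
move=> a0 udec upos vP.
have vdec x z : 0 < x -> x < z -> v z < v x.
  move=> x0 xz; have [v0 uv] := vP x x0.
  have [v0' uv'] := vP z (lt_trans x0 xz).
  rewrite ltNge le_eqVlt; apply/negP => /predU1P[E|/udec].
    by move: xz; rewrite -uv -uv' E ltxx.
  by rewrite uv uv' => /(_ v0); rewrite ltNge ltW.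
split.
- move=> x z x0 xz; apply: udec; last by rewrite ltr_pM2r ?invr_gt0 // vdec.
  by rewrite divr_gt0 //; have [] := vP z (lt_trans x0 xz).
- by move=> x x0; rewrite upos // divr_gt0 //; have [] := vP x x0.
- move=> q q0; have [vq0 uvq] := vP q q0.
  have va0 : 0 < v q * a by rewrite mulr_gt0.
  exists (u (v q * a)); first exact: upos.
  have [v0 uv] := vP _ (upos _ va0).
  by rewrite (decreasing_pos_inj udec v0 va0 uv) mulfK // gt_eqF.
Qed.

End RescaledInverse.

(** * Connectedness of the network *)

Section Topology.
Variables (J Rt : finType) (A : J -> Rt -> bool).
Hypothesis Aconn : connected_network A.

(** Otherwise a path starting at [j] could never leave [j]. *)
Lemma connected_crossing_route (j : J) : (1 < #|J|)%N ->
  exists r l, [/\ l != j, A j r & A l r].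
Proof.
move=> J2; have [l lj] : exists l : J, l != j.
  have : (0 < #|predC1 j|)%N by rewrite cardC1 -subn1 subn_gt0.
  by move=> /card_gt0P[l lj]; exists l.
apply: contrapT => nocross.
have [K [js [rs [js0 jsK step]]]] := Aconn j l.
suff /(_ K (leqnn K)) E : forall k, (k <= K)%N -> js k = j.
  by move: lj; rewrite -jsK E eqxx.
elim=> // k IH kK; have [Ak Ak1] := step k kK.
rewrite (IH (ltnW kK)) in Ak.
by apply/eqP/negPn/negP => neq; apply: nocross; exists (rs k), (js k.+1).
Qed.

Lemma connected_constant (T : Type) (f : J -> T) :
  (forall r j l, A j r -> A l r -> f j = f l) -> forall j l, f j = f l.
Proof.
move=> fr j l; have [K [js [rs [<- <- step]]]] := Aconn j l.
have H k : (k <= K)%N -> f (js 0%N) = f (js k).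
  elim: k => // k IH kK; have [Ak Ak1] := step k kK.
  by rewrite (IH (ltnW kK)); exact: fr Ak Ak1.
exact: H.
Qed.

End Topology.

(** * Flow scalability forces power-law marginal utilities *)

Section FlowScalable.
Variables (R : realType) (J Rt : finType).
Variables (A : J -> Rt -> bool) (C : J -> R) (U : Rt -> R -> R).
Variables (Lam : (Rt -> R) -> (Rt -> R)) (loc : J -> Rt).
Hypothesis J2 : (1 < #|J|)%N.
Hypothesis routeP : forall r, exists j, A j r.
Hypothesis Aconn : connected_network A.
Hypothesis locP : forall l j, A l (loc j) = (l == j).
Hypothesis Uinc : forall r, increasing_pos (U r).
Hypothesis Udiff : forall r, differentiable_pos (U r).
Hypothesis Uconc : forall r, strictly_concave_pos (U r).
Hypothesis Urange : forall r, derivative_range_pos (U r).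
Hypothesis LamP : forall y, positive_vec y ->
  argmax (feasible A C) (utility U y) (Lam y).

Local Notation u r := (derive1 (U r)).

Lemma marginal_pos r x : 0 < x -> 0 < u r x.
Proof.
by move=> x0; have : [set z | 0 < z] (u r x) by rewrite -(Urange r); exists x.
Qed.

Lemma marginal_decreasing r x z : 0 < x -> x < z -> u r z < u r x.
Proof. by apply: derive1_decreasing; [exact: Udiff|exact: Uconc]. Qed.

Lemma marginal_inverse :
  exists v : Rt -> R -> R, forall r q, 0 < q -> 0 < v r q /\ u r (v r q) = q.
Proof.
have H (rq : Rt * R) : exists x, 0 < rq.2 -> 0 < x /\ u rq.1 x = rq.2.
  case: rq => r q /=; have [q0|q0] := ltP 0 q; last by exists 0.
  have : [set z | 0 < z] q by [].
  by rewrite -(Urange r) => -[x x0 xq]; exists x.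
have [v vP] := choice H.
by exists (fun r q => v (r, q)) => r q; exact: (vP (r, q)).
Qed.

Lemma sum_incidence (r : Rt) (p : J -> R) :
  \sum_j (A j r)%:R * p j = \sum_(j in [set j | A j r]%SET) p j.
Proof.
rewrite [RHS]big_mkcond; apply: eq_bigr => j _; rewrite inE.
by case: (A j r); rewrite ?mul1r ?mul0r.
Qed.

Hypothesis scal : flow_scalable Lam.

(** Fix one saturating allocation [L].  For any prices [p], the numbers of flows
    [y] can be chosen so that [p] supports [L] at [y]; sufficiency of the price
    conditions gives [Lam y = L], hence [Lam (a y) = L], and their necessity at
    [a y] says that the rescaled marginal utilities again add up along
    routes. *)
Lemma flow_scalable_splits v a r : 0 < a ->
  (forall r q, 0 < q -> 0 < v r q /\ u r (v r q) = q) ->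
  splits_over (fun q => u r (v r q / a))
    (fun j q => u (loc j) (v (loc j) q / a)) [set j | A j r]%SET.
Proof.
move=> a0 vP p p0.
have one0 : @positive_vec R Rt (fun=> 1) by move=> s; exact: ltr01.
pose L := Lam (fun=> 1).
have Lmax : argmax (feasible A C) (utility U (fun=> 1)) L by exact: LamP.
have [[L0 _] _] := Lmax.
pose q s := \sum_j (A j s)%:R * p j.
have q0 s : 0 < q s.
  have [j js] := routeP s; rewrite /q (bigD1 j) //= js mul1r ltr_wpDr //.
  by apply: sumr_ge0 => i _; rewrite mulr_ge0 ?ler0n // ltW.
have v0 s : 0 < v s (q s) := (vP s _ (q0 s)).1.
(* The ratios [L s / y s] must be the points of marginal utility [q s]. *)
pose y s := L s / v s (q s).
have y0 : positive_vec y by move=> s; rewrite divr_gt0.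
have ratio s : L s / y s = v s (q s).
  by rewrite /y invf_div mulrC divfK // gt_eqF.
have LC j : \sum_s (A j s)%:R * L s = C j.
  by apply: (argmax_saturates Uinc one0 Lmax (r := loc j)) => l; exact: locP.
have Ly : Lam y = L.
  apply: (supported_by_prices_argmax_eq Udiff Uconc y0 Lmax.1 _ (LamP y0)).
  by split=> // s; rewrite ratio (vP s _ (q0 s)).2.
have ay0 : positive_vec (fun s => a * y s) by move=> s; rewrite mulr_gt0.
have := LamP ay0; rewrite -scal // Ly => aLmax.
have [_ _ /(_ r)] :=
  argmax_supported_by_prices Udiff Uinc locP marginal_pos ay0 aLmax.
have aratio s : L s / (a * y s) = v s (q s) / a.
  by rewrite invfM mulrCA mulrC ratio.
have qloc j : q (loc j) = p j.
  rewrite /q (bigD1 j) //= locP eqxx mul1r big1 ?addr0 // => l /negPf lj.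
  by rewrite locP lj mul0r.
rewrite aratio => E; rewrite -!sum_incidence -/(q r) E; apply: eq_bigr => j _.
by rewrite aratio qloc.
Qed.

(** On a route with several links the splitting equation makes the rescaling of
    all its links linear with one slope; connectedness carries the slope to all
    links.  A route with a single link behaves like the local route of that
    link. *)
Lemma flow_scalable_common_slope a : 0 < a ->
  exists c, forall r x, 0 < x -> u r (x / a) = c * u r x.
Proof.
move=> a0; have [v vP] := marginal_inverse.
pose g r q := u r (v r q / a).
have gb r : increasing_bijection_pos (g r).
  apply: rescaled_inverse_increasing_bijection => //.
  - exact: marginal_decreasing.
  - exact: marginal_pos.
  - exact: vP.
have slope r j : A j r -> (1 < #|[set j | A j r]%SET|)%N ->
    forall q, 0 < q -> g (loc j) q = q * g (loc j) 1 /\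
                       g r q = q * g (loc j) 1.
  move=> jr r2; apply: (@splits_over_linear _ _ (g r) (fun l => g (loc l))
    [set j | A j r]%SET) => //; last by rewrite inE.
  exact: flow_scalable_splits.
have card2 r j l : A j r -> A l r -> l != j -> (1 < #|[set j | A j r]%SET|)%N.
  move=> jr lr lj; rewrite (cardsD1 j) inE jr ltnS.
  by apply/card_gt0P; exists l; rewrite !inE lj.
have [j0] : exists j0 : J, True.
  by have /card_gt0P[j _] := ltnW J2; exists j.
move=> _; exists (g (loc j0) 1).
have const j : g (loc j) 1 = g (loc j0) 1.
  apply: (connected_constant Aconn (f := fun j => g (loc j) 1)) => r i l ir lr.
  have [->//|il] := eqVneq l i; have r2 := card2 r i l ir lr il.
  have [_] := slope r i ir r2 1 ltr01; have [_ ->] := slope r l lr r2 1 ltr01.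
  by rewrite !mul1r.
have lin r q : 0 < q -> g r q = q * g (loc j0) 1.
  move=> q0; have [j jr] := routeP r.
  have [r2|r1] := ltnP 1 #|[set j | A j r]%SET|.
    by have [_ ->] := slope r j jr r2 q q0; rewrite const.
  have Sr : [set j | A j r]%SET = [set j]%SET.
    by apply/esym/eqP; rewrite eqEcard finset.sub1set inE jr cards1.
  have [r' [l [lj jr' lr']]] := connected_crossing_route Aconn j J2.
  have [gj _] := slope r' j jr' (card2 r' j l jr' lr' lj) q q0.
  have := @flow_scalable_splits v a r a0 vP (fun=> q) (fun=> q0).
  by rewrite Sr !big_set1 -/(g r q) -/(g (loc j) q) gj const.
move=> r x x0; have ux0 := marginal_pos r x0.
have [v0 uv] := vP r _ ux0.
have := lin r _ ux0.
by rewrite /g (decreasing_pos_inj (@marginal_decreasing r) v0 x0 uv) [RHS]mulrC.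
Qed.

(** Rescaling by [a] and then by [b] is rescaling by [a b], so the common slope
    is multiplicative and monotone in [a], hence a power. *)
Lemma flow_scalable_power : exists2 alpha, 0 < alpha &
  forall r x, 0 < x -> u r x = u r 1 * x `^ (- alpha).
Proof.
have [j0] : exists j0 : J, True.
  by have /card_gt0P[j _] := ltnW J2; exists j.
pose r0 := loc j0; pose c a := u r0 a^-1 / u r0 1 => _.
have u1 r : 0 < u r 1 by exact: marginal_pos.
have cP r a x : 0 < a -> 0 < x -> u r (x / a) = c a * u r x.
  move=> a0 x0; have [k kP] := flow_scalable_common_slope a0.
  rewrite kP //; congr (_ * _).
  by rewrite /c -[a^-1]mul1r kP // mulfK // gt_eqF.
have cpos a : 0 < a -> 0 < c a.
  by move=> a0; rewrite divr_gt0 // marginal_pos // invr_gt0.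
have [|//||alpha al0 cE] := @multiplicative_pos_power R c.
- move=> a b a0 ab; have b0 := lt_trans a0 ab.
  rewrite /c ltr_pM2r ?invr_gt0 //; apply: marginal_decreasing.
    by rewrite invr_gt0.
  by rewrite ltf_pV2.
- move=> a b a0 b0; apply: (@mulIf _ (u r0 1)); first by rewrite gt_eqF.
  rewrite -[RHS]mulrA -(cP r0 b) // -(cP r0 a) ?divr_gt0 // -cP ?mulr_gt0 //.
  by rewrite invfM mulrA mulrAC.
exists alpha => // r x x0.
have := cP r x x x0 x0; rewrite divff ?gt_eqF // => ->.
by rewrite cE // powRN mulrAC mulfV ?mul1r // gt_eqF // powR_gt0.
Qed.

End FlowScalable.

(** * Weighted alpha-fair utilities *)

Section AlphaFair.
Variables (R : realType) (Rt : finType).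
Implicit Types (y w L : Rt -> R) (V : Rt -> R -> R).

(** An antiderivative of [x `^ (- alpha)] on the half-line; weighted by [w r],
    it is the utility of route [r] in the alpha-fair objective. *)
Definition isoelastic (alpha x : R) : R :=
  if alpha == 1 then ln x else x `^ (1 - alpha) / (1 - alpha).

Lemma alpha_fairE (alpha : R) w y L :
  alpha_fair alpha w y L = utility (fun r x => w r * isoelastic alpha x) y L.
Proof.
rewrite /alpha_fair /utility /isoelastic; case: ifP => _; congr (_ * _);
  apply: eq_bigr => r _; by rewrite ?mulrA ?[y r * w r]mulrC // mulrAC.
Qed.

Lemma is_derive_isoelastic (alpha x : R) : 0 < x ->
  is_derive x 1 (isoelastic alpha) (x `^ (- alpha)).
Proof.
move=> x0; rewrite /isoelastic; have [->|al1] := eqVneq alpha 1.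
  by rewrite powRN powRr1 ?ltW //; exact: is_derive1_ln.
have al10 : 1 - alpha != 0 by rewrite subr_eq0 eq_sym.
have -> : (fun z : R => z `^ (1 - alpha) / (1 - alpha)) =
          (1 - alpha)^-1 \*: (@powR R ^~ (1 - alpha)).
  by apply/funext => z /=; rewrite mulrC.
have dp := is_derive1_powR (1 - alpha) x0.
apply: is_derive_eq; rewrite [LHS]mulrA mulVf // mul1r; congr (_ `^ _); ring.
Qed.

Lemma isoelastic_rescale (alpha a : R) : 0 < a ->
  exists k K, 0 < k /\ forall x, 0 < x ->
    isoelastic alpha (x / a) = k * isoelastic alpha x + K.
Proof.
move=> a0; rewrite /isoelastic; have aV0 : 0 < a^-1 by rewrite invr_gt0.
case: (alpha == 1).
  exists 1, (ln a^-1); split=> // x x0.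
  by rewrite lnM ?posrE // mul1r.
exists (a^-1 `^ (1 - alpha)), 0; split; first by rewrite powR_gt0.
by move=> x x0; rewrite powRM ?ltW // addr0 mulrCA mulrA.
Qed.

Lemma argmax_affine (T : Type) (D : set T) (F G : T -> R) (k K : R) : 0 < k ->
  (forall x, D x -> F x = k * G x + K) -> argmax D F = argmax D G.
Proof.
move=> k0 FG; apply/seteqP; split=> x [Dx xmax]; split=> // z Dz;
  by have := xmax z Dz; rewrite !FG // lerD2r ler_pM2l.
Qed.

Lemma utility_affine V V' y L (k : R) (K : Rt -> R) :
  (forall r, V r (L r / y r) = k * V' r (L r / y r) + K r) ->
  utility V y L = k * utility V' y L + (\sum_r y r)^-1 * \sum_r y r * K r.
Proof.
move=> VV'; rewrite /utility mulrCA -mulrDr; congr (_ * _).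
rewrite mulr_sumr -big_split /=; apply: eq_bigr => r _; rewrite VV'; ring.
Qed.

Lemma utility_rescale V y L (a : R) : 0 < a ->
  utility V (fun r => a * y r) L = utility (fun r x => V r (x / a)) y L.
Proof.
move=> a0; rewrite /utility.
have -> : \sum_r a * y r * V r (L r / (a * y r)) =
          a * \sum_r y r * V r (L r / y r / a).
  rewrite mulr_sumr; apply: eq_bigr => r _.
  by rewrite -mulrA; congr (_ * (_ * V r _)); rewrite invfM mulrA mulrAC.
by rewrite -mulr_sumr invfM mulrACA mulVf ?gt_eqF // mul1r.
Qed.

(** Scaling the numbers of flows changes an alpha-fair utility by a positive
    factor and a constant, neither of which depends on the allocation. *)
Lemma maximizes_alpha_fair_flow_scalable (J : finType) (A : J -> Rt -> bool)
  (C : J -> R) (Lam : (Rt -> R) -> (Rt -> R)) :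
  maximizes_alpha_fair A C Lam -> flow_scalable Lam.
Proof.
move=> [alpha [w [_ _ LamW]]] a y a0 y0.
have ay0 : positive_vec (fun r => a * y r) by move=> r; rewrite mulr_gt0.
have [k [K [k0 iso]]] := isoelastic_rescale alpha a0.
suff /esym E : argmax (feasible A C) (alpha_fair alpha w (fun r => a * y r)) =
    argmax (feasible A C) (alpha_fair alpha w y).
  have : [set Lam y] (Lam y) by [].
  by rewrite -LamW // E LamW.
apply: (argmax_affine (K := (\sum_r y r)^-1 * \sum_r y r * (w r * K)) k0).
move=> L [L0 _]; rewrite !alpha_fairE utility_rescale //.
apply: utility_affine => r; rewrite iso ?divr_gt0 //; ring.
Qed.

End AlphaFair.

Unset Implicit Arguments.

Theorem corollary6p1 (R : realType) (J Rt : finType)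
  (A : J -> Rt -> bool) (C : J -> R) (U : Rt -> R -> R)
  (Lam : (Rt -> R) -> (Rt -> R))
  (hJ : (2 <= #|J|)%N)
  (hroute : forall r : Rt, exists j : J, A j r)
  (hC : forall j : J, 0 < C j)
  (hconn : connected_network A)
  (hlocal : local_traffic A)
  (hinc : forall r : Rt, increasing_pos (U r))
  (hdiff : forall r : Rt, differentiable_pos (U r))
  (hconc : forall r : Rt, strictly_concave_pos (U r))
  (hrange : forall r : Rt, derivative_range_pos (U r))
  (hLam : forall y : Rt -> R, positive_vec y ->
     argmax (feasible A C) (utility U y) (Lam y)) :
  flow_scalable Lam <-> maximizes_alpha_fair A C Lam.
Proof.
split; last exact: maximizes_alpha_fair_flow_scalable.
move=> scal; have [loc locA] := choice hlocal.
have locP l j : A l (loc j) = (l == j).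
  have [Aj Al] := locA j; have [->//|lj] := eqVneq l j.
  exact/negbTE/Al.
have upos r x : 0 < x -> 0 < derive1 (U r) x by exact: marginal_pos.
have [alpha al0 power] := flow_scalable_power hJ hroute hconn locP hinc hdiff
  hconc hrange hLam scal.
pose w r := derive1 (U r) 1; pose V r x := w r * isoelastic alpha x.
exists alpha, w; split=> // [r|y y0]; first exact: upos.
(* Equal marginal utilities: [U r] and [V r] differ by a constant. *)
pose K r := U r 1 - V r 1.
have UV r x : 0 < x -> U r x = 1 * V r x + K r.
  move=> x0; rewrite mul1r addrC; apply/eqP; rewrite -subr_eq; apply/eqP.
  refine (@eq_derive1_diff _ (U r) (V r) x 1 (@hdiff r) _ x0 ltr01) => t t0.
  rewrite power //; have -> : V r = w r \*: isoelastic alpha by [].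
  by have dt := is_derive_isoelastic alpha t0; exact: is_deriveZ.
have -> : argmax (feasible A C) (alpha_fair alpha w y) =
    argmax (feasible A C) (utility U y).
  symmetry; apply: (argmax_affine (k := 1)
    (K := (\sum_r y r)^-1 * \sum_r y r * K r)) => // L [L0 _].
  by rewrite alpha_fairE; apply: utility_affine => r; rewrite UV ?divr_gt0.
apply/seteqP; split=> [L Lmax|_ ->]; last exact: hLam.
exact: (argmax_unique hdiff hconc hinc locP upos y0 (hLam y y0) Lmax).
Qed.
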